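(* Let $n$ be a positive integer. An $n$-satisfactory coloring of $K_n$ is translation invariant if and only if it is multiplicative.
   Context: $[n]=\{1,\dots,n\}$. $K_n$ is the set of positive integers all of whose prime factors are less than or equal to $n$. An $n$-satisfactory coloring of $K_n$ is a map $c:K_n\to[n]$ with $c(i)=i$ for all $i\in[n]$ and such that for every $a\in K_n$ the colors $c(a),c(2a),\dots,c(na)$ are all different. It is multiplicative if there is an abelian group structure $([n],\oplus)$ on the set $[n]$ such that $c(ab)=c(a)\oplus c(b)$ for all $a,b\in K_n$. For a coloring $c$ of $K_n$ and $k\in K_n$, $c_k$ denotes the coloring of $K_n$ in which two numbers $m,m'\in K_n$ receive the same color if and only if $c(km)=c(km')$. The coloring $c$ is translation invariant if $c_k=c$ for all $k\in K_n$, where equality of colorings means that they have the same color classes; that is, for all $k,m,m'\in K_n$, $c(km)=c(km')$ if and only if $c(m)=c(m')$. *)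

(* Defs.v *)
From mathcomp Require Import all_boot.

Set Implicit Arguments.
Unset Strict Implicit.
Unset Printing Implicit Defensive.

Definition box (n : nat) : Type := {i : nat | 0 < i <= n}.

(* [pi.-nat a] contains the condition [0 < a]. *)
Definition Kset (n : nat) : Type := {a : nat | [pred p | p <= n].-nat a}.

Lemma Kset_mul_proof (n : nat) (a b : Kset n) :
  [pred p | p <= n].-nat (val a * val b).
Proof. by rewrite pnatM (valP a) (valP b). Qed.

Definition Kmul (n : nat) (a b : Kset n) : Kset n :=
  exist _ (val a * val b) (Kset_mul_proof a b).

Lemma box_Kset_proof (n : nat) (i : box n) : [pred p | p <= n].-nat (val i).
Proof.
case/andP: (valP i) => i_gt0 le_i_n.
apply/pnatP => // p _ p_dvd_i.
exact: leq_trans (dvdn_leq i_gt0 p_dvd_i) le_i_n.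
Qed.

Definition box_Kset (n : nat) (i : box n) : Kset n :=
  exist _ (val i) (box_Kset_proof i).

Definition satisfactory (n : nat) (c : Kset n -> box n) : Prop :=
  (forall i : box n, c (box_Kset i) = i) /\
  (forall a : Kset n, injective (fun i : box n => c (Kmul (box_Kset i) a))).

Definition abelian_group_law (T : Type) (op : T -> T -> T) : Prop :=
  exists (e : T) (inv : T -> T),
    [/\ associative op, commutative op, left_id e op & left_inverse e inv op].

Definition multiplicative (n : nat) (c : Kset n -> box n) : Prop :=
  exists op : box n -> box n -> box n,
    abelian_group_law op /\
    (forall a b : Kset n, c (Kmul a b) = op (c a) (c b)).

(* A coloring matters here only through its color classes, so [translate c k]
   may keep the color names inherited from [c]; translates are compared
   with [same_classes], never with [=]. *)
Definition translate (n : nat) (c : Kset n -> box n) (k : Kset n) :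
  Kset n -> box n := fun m => c (Kmul k m).

Definition same_classes (n : nat) (c d : Kset n -> box n) : Prop :=
  forall m m' : Kset n, c m = c m' <-> d m = d m'.

Definition translation_invariant (n : nat) (c : Kset n -> box n) : Prop :=
  forall k : Kset n, same_classes (translate c k) c.

(* Main.v *)
Require Import Defs.
From mathcomp Require Import all_boot.

(** Translation invariance says that the color of [a * b] depends on [b] only
through its color, hence, by commutativity, on [a] and [b] only through their
colors. Since [c] fixes [[n]], every color [i] is the color of the number [i]
itself, so the induced operation on colors is [i + j := c (i * j)]
([coloring_Kmul]); it inherits associativity, commutativity and the neutral
element [1] from multiplication in [K_n]. Inverses are where the satisfactory
condition enters: the multiples [a, 2a, ..., na] receive distinct colors,
so by finiteness one of them receives color [1] ([inverse_of_injective]).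

Conversely, if [c] is a morphism to a group, then [c (k * m) = c (k * m')]
amounts to [c m = c m'] by cancellation. *)

Section KsetMonoid.

Variable n : nat.
Implicit Types a b d : Kset n.

Lemma KmulC a b : Kmul a b = Kmul b a.
Proof. by apply: val_inj; apply: mulnC. Qed.

Lemma KmulA a b d : Kmul a (Kmul b d) = Kmul (Kmul a b) d.
Proof. by apply: val_inj; apply: mulnA. Qed.

End KsetMonoid.

Lemma box_one_proof (n : nat) (n_gt0 : 0 < n) : 0 < 1 <= n.
Proof. exact: n_gt0. Qed.

Definition box_one (n : nat) (n_gt0 : 0 < n) : box n :=
  exist _ 1 (box_one_proof n n_gt0).

Lemma Kmul1 (n : nat) (n_gt0 : 0 < n) (a : Kset n) :
  Kmul (box_Kset (box_one n n_gt0)) a = a.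
Proof. by apply: val_inj; apply: mul1n. Qed.

Lemma ord_of_box_proof (n : nat) (i : box n) : (val i).-1 < n.
Proof. by case: i => -[|i]. Qed.

Definition ord_of_box (n : nat) (i : box n) : 'I_n :=
  Ordinal (ord_of_box_proof n i).

Definition box_of_ord (n : nat) (i : 'I_n) : box n := exist _ i.+1 (ltn_ord i).

Lemma ord_of_boxK (n : nat) : cancel (@ord_of_box n) (@box_of_ord n).
Proof. by move=> [[|i] i_bd] //; apply: val_inj. Qed.

Lemma box_of_ordK (n : nat) : cancel (@box_of_ord n) (@ord_of_box n).
Proof. by move=> i; apply: val_inj. Qed.

(** An injective self-map of a finite set is onto. The right inverse is given
as data, so that the group inverse can be built from it without choice. *)
Lemma inverse_of_injective (n : nat) (f : box n -> box n) :
  injective f -> {g : box n -> box n | cancel g f}.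
Proof.
move=> f_inj.
pose h : 'I_n -> 'I_n := @ord_of_box n \o f \o @box_of_ord n.
have h_inj : injective h.
  apply: inj_comp; last exact: can_inj (@box_of_ordK n).
  by apply: inj_comp f_inj; apply: can_inj (@ord_of_boxK n).
exists (fun i => box_of_ord n (invF h_inj (ord_of_box n i))) => i.
by apply: (can_inj (@ord_of_boxK n)); apply: (f_invF h_inj).
Qed.

Section Coloring.

Variables (n : nat) (c : Kset n -> box n).
Hypothesis c_sat : satisfactory c.

Definition color_op (i j : box n) : box n :=
  c (Kmul (box_Kset i) (box_Kset j)).

Lemma coloring_representative (a : Kset n) : c (box_Kset (c a)) = c a.
Proof. by case: c_sat => c_id _; apply: c_id. Qed.

(** Each factor may be replaced by the number naming its color. *)
Lemma coloring_Kmul (c_inv : translation_invariant c) (a b : Kset n) :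
  c (Kmul a b) = color_op (c a) (c b).
Proof.
have congr_r k m m' : c m = c m' -> c (Kmul k m) = c (Kmul k m').
  by move/(c_inv k m m').
rewrite /color_op.
rewrite (congr_r _ _ _ (coloring_representative b)).
rewrite (KmulC _ a) (KmulC _ (box_Kset (c a))).
by apply: congr_r; rewrite coloring_representative.
Qed.

Lemma color_op_group (n_gt0 : 0 < n) (c_inv : translation_invariant c) :
  abelian_group_law color_op.
Proof.
have [c_id c_inj] := c_sat.
have cM := coloring_Kmul c_inv.
pose inv i := sval (inverse_of_injective n _ (c_inj (box_Kset i)))
                   (box_one n n_gt0).
exists (box_one n n_gt0), inv; split.
- move=> i j k.
  by rewrite -[i]c_id -[j]c_id -[k]c_id -!cM KmulA.
- by move=> i j; rewrite /color_op KmulC.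
- by move=> i; rewrite /color_op Kmul1 c_id.
- move=> i; rewrite /inv.
  case: (inverse_of_injective _ _ _) => g gK /=.
  exact: gK.
Qed.

End Coloring.

Lemma group_law_cancel (T : Type) (op : T -> T -> T) (x : T) :
  abelian_group_law op -> injective (op x).
Proof.
case=> e [inv [opA _ op1 opV]]; apply: (can_inj (g := op (inv x))) => y.
by rewrite opA opV op1.
Qed.

Theorem theorem1p14 (n : nat) (n_gt0 : 0 < n) (c : Kset n -> box n)
    (c_sat : satisfactory c) :
  translation_invariant c <-> multiplicative c.
Proof.
split=> [c_inv | [op [op_group cM]] k m m'].
  exists (color_op n c); split; first exact: color_op_group.
  exact: coloring_Kmul.
rewrite /translate !cM; split=> [|-> //].
exact: group_law_cancel.
Qed.
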